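(* Let $\mathcal{C}$ be a pivotal $\Bbbk$-category. If $t=\{t_X\}_{X\in\mathcal{O}}$ is a left (resp. right) ambidextrous trace on a class $\mathcal{O}$ of objects of $\mathcal{C}$, then there exists a unique left (resp. right) trace $\mathsf{t}$ on $\mathcal{I}^l_{\mathcal O}$ (resp. $\mathcal{I}^r_{\mathcal O}$) such that $\mathsf{t}_{|\mathcal{O}}=t$, i.e. $\mathsf{t}_X=t_X$ for all $X\in\mathcal{O}$.
   Context: $\Bbbk$ is a commutative ring. Pivotal categories. A pivotal category is a strict monoidal category $\mathcal{C}$ with unit $\mathbf{1}$ in which every object $X$ has a dual object $X^*$ and morphisms $\mathrm{ev}_X:X^*\otimes X\to\mathbf{1}$, $\mathrm{coev}_X:\mathbf{1}\to X\otimes X^*$, $\widetilde{\mathrm{ev}}_X:X\otimes X^*\to\mathbf{1}$, $\widetilde{\mathrm{coev}}_X:\mathbf{1}\to X^*\otimes X$ such that $(\mathrm{ev}_X,\mathrm{coev}_X)$ is a left duality, $(\widetilde{\mathrm{ev}}_X,\widetilde{\mathrm{coev}}_X)$ is a right duality, and the induced left and right dual functors coincide as monoidal functors; $f^*:Y^*\to X^*$ denotes the dual of $f:X\to Y$. The pivotal structure is the monoidal natural isomorphism $\phi_X=(\widetilde{\mathrm{ev}}_X\otimes\mathrm{id}_{X^{**}})(\mathrm{id}_X\otimes\mathrm{coev}_{X^*}):X\to X^{**}$. A pivotal $\Bbbk$-category is a pivotal category whose hom-sets are $\Bbbk$-modules, whose composition and monoidal product of morphisms are $\Bbbk$-bilinear,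 and such that $\mathrm{End}_{\mathcal C}(\mathbf{1})$ is a free $\Bbbk$-module of rank one. Partial traces. For $f\in\mathrm{Hom}_{\mathcal C}(X\otimes Y,X\otimes Z)$, $\mathrm{tr}_l^X(f)=(\mathrm{ev}_X\otimes\mathrm{id}_Z)(\mathrm{id}_{X^*}\otimes f)(\widetilde{\mathrm{coev}}_X\otimes\mathrm{id}_Y)\in\mathrm{Hom}_{\mathcal C}(Y,Z)$. For $g\in\mathrm{Hom}_{\mathcal C}(Y\otimes X,Z\otimes X)$, $\mathrm{tr}_r^X(g)=(\mathrm{id}_Z\otimes\widetilde{\mathrm{ev}}_X)(g\otimes\mathrm{id}_{X^*})(\mathrm{id}_Y\otimes\mathrm{coev}_X)\in\mathrm{Hom}_{\mathcal C}(Y,Z)$. Ideals and traces. An object $U$ is a retract of $X$ if there are $p:X\to U$, $q:U\to X$ with $pq=\mathrm{id}_U$. A left (resp. right) ideal of $\mathcal{C}$ is a class $\mathcal{I}$ of objects closed under retracts and such that $Y\otimes X\in\mathcal{I}$ (resp. $X\otimes Y\in\mathcal{I}$) for all $X\in\mathcal{I}$, $Y\in\mathcal{C}$. A left (resp. right) trace on a left (resp. right) ideal $\mathcal{I}$ is a family of $\Bbbk$-linear forms $\mathsf{t}=\{\mathsf{t}_X:\mathrm{End}_{\mathcal C}(X)\to\Bbbk\}_{X\in\mathcal{I}}$ such that $\mathsf{t}_V(gh)=\mathsf{t}_U(hg)$ for all $U,V\in\mathcal{I}$, $g:U\to V$, $h:V\to U$, and $\mathsf{t}_{Y\otimes X}(f)=\mathsf{t}_X(\mathrm{tr}_l^Y(f))$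 for all $X\in\mathcal{I}$, $Y\in\mathcal{C}$, $f\in\mathrm{End}_{\mathcal C}(Y\otimes X)$ (resp. $\mathsf{t}_{X\otimes Z}(f)=\mathsf{t}_X(\mathrm{tr}_r^Z(f))$ for all $X\in\mathcal{I}$, $Z\in\mathcal{C}$, $f\in\mathrm{End}_{\mathcal C}(X\otimes Z)$). Generated ideals. $\mathcal{I}^l_{\mathcal O}$ is the class of retracts of objects $Y\otimes X$ with $X\in\mathcal{O}$, $Y\in\mathcal{C}$ (the smallest left ideal containing $\mathcal{O}$); $\mathcal{I}^r_{\mathcal O}$ is the class of retracts of objects $X\otimes Z$ with $X\in\mathcal{O}$, $Z\in\mathcal{C}$ (the smallest right ideal containing $\mathcal{O}$). Ambidextrous traces. A family of $\Bbbk$-linear forms $t=\{t_X:\mathrm{End}_{\mathcal C}(X)\to\Bbbk\}_{X\in\mathcal{O}}$ is a left ambidextrous trace on $\mathcal{O}$ if $$t_X\bigl(\phi_X^{-1}(\mathrm{tr}_l^{X'}(f))^*\phi_X\bigr)=t_{X'}\bigl(\mathrm{tr}_r^{X^*}(f)\bigr)\quad\text{for all }X,X'\in\mathcal{O},\ f\in\mathrm{End}_{\mathcal C}(X'\otimes X^* ),$$ and a right ambidextrous trace on $\mathcal{O}$ if $$t_X\bigl(\phi_X^{-1}(\mathrm{tr}_r^{X'}(g))^*\phi_X\bigr)=t_{X'}\bigl(\mathrm{tr}_l^{X^*}(g)\bigr)\quad\text{for all }X,X'\in\mathcal{O},\ g\in\mathrm{End}_{\mathcal C}(X^*\otimes X').$$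 *)

(* Defs.v *)
From HB Require Import structures.
From mathcomp Require Import all_boot all_order all_algebra.
From Stdlib Require Import ProofIrrelevance.

Set Implicit Arguments.
Unset Strict Implicit.
Unset Printing Implicit Defensive.
Import GRing.Theory.
Local Open Scope ring_scope.

(* Strictness is an equality between objects, so the strictness laws on
   morphisms are stated up to transport along such equalities. *)
Definition castm (T : Type) (H : T -> T -> Type) (X X' Y Y' : T)
    (eX : X = X') (eY : Y = Y') (f : H X Y) : H X' Y' :=
  ecast Z (H X' Z) eY (ecast Z (H Z Y) eX f).

Record strictMonCat := StrictMonCat {
  ob :> Type;
  mor : ob -> ob -> Type;
  idm : forall X, mor X X;
  comp : forall X Y Z, mor Y Z -> mor X Y -> mor X Z;
  compA : forall W X Y Z (h : mor Y Z) (g : mor X Y) (f : mor W X),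
    comp h (comp g f) = comp (comp h g) f;
  comp1m : forall X Y (f : mor X Y), comp (idm Y) f = f;
  compm1 : forall X Y (f : mor X Y), comp f (idm X) = f;
  one : ob;
  tens : ob -> ob -> ob;
  tensm : forall X X' Y Y', mor X X' -> mor Y Y' -> mor (tens X Y) (tens X' Y');
  tensm1 : forall X Y, tensm (idm X) (idm Y) = idm (tens X Y);
  tensm_comp : forall X X' X'' Y Y' Y''
    (g : mor X' X'') (f : mor X X') (g' : mor Y' Y'') (f' : mor Y Y'),
    tensm (comp g f) (comp g' f') = comp (tensm g g') (tensm f f');
  tensA : forall X Y Z, tens (tens X Y) Z = tens X (tens Y Z);
  tens1l : forall X, tens one X = X;
  tens1r : forall X, tens X one = X;
  tensmA : forall X X' Y Y' Z Z' (f : mor X X') (g : mor Y Y') (h : mor Z Z'),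
    castm (tensA X Y Z) (tensA X' Y' Z') (tensm (tensm f g) h)
      = tensm f (tensm g h);
  tensm1l : forall X Y (f : mor X Y),
    castm (tens1l X) (tens1l Y) (tensm (idm one) f) = f;
  tensm1r : forall X Y (f : mor X Y),
    castm (tens1r X) (tens1r Y) (tensm f (idm one)) = f
}.

Arguments mor {s} X Y.
Arguments idm {s} X.
Arguments one {s}.
Arguments tens {s} X Y.

Declare Scope ob_scope.
Declare Scope mor_scope.
Delimit Scope ob_scope with ob.
Delimit Scope mor_scope with mor.
Bind Scope ob_scope with ob.
Bind Scope mor_scope with mor.
Notation "X ⊗ Y" := (tens X Y) (at level 40, left associativity) : ob_scope.
Notation "𝟙" := one : ob_scope.
Notation "f ⊗ g" := (tensm f g) (at level 40, left associativity) : mor_scope.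
Notation "g ∘ f" := (comp g f) (at level 50, left associativity) : mor_scope.
Arguments mor {s} (X Y)%_ob.
Arguments idm {s} X%_ob.
Arguments tens {s} (X Y)%_ob.
Arguments comp {s} {X Y Z}%_ob (g f)%_mor : rename.
Arguments tensm {s} {X X' Y Y'}%_ob (f g)%_mor : rename.
Local Open Scope ob_scope.
Local Open Scope mor_scope.

Section Coherence.
Variable C : strictMonCat.
Implicit Types X Y Z : C.

(* The identity of X, viewed as a morphism X -> Y along an equality X = Y.
   [assoc], [lunit], [runit] and their inverses below are the invisible identities
   of a strict category. *)
Definition eqm X Y (e : X = Y) : mor X Y := ecast W (mor X W) e (idm X).

Definition assoc X Y Z : mor (X ⊗ Y ⊗ Z) (X ⊗ (Y ⊗ Z)) := eqm (tensA X Y Z).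
Definition assocV X Y Z : mor (X ⊗ (Y ⊗ Z)) (X ⊗ Y ⊗ Z) :=
  eqm (esym (tensA X Y Z)).
Definition lunit X : mor (𝟙 ⊗ X) X := eqm (tens1l X).
Definition lunitV X : mor X (𝟙 ⊗ X) := eqm (esym (tens1l X)).
Definition runit X : mor (X ⊗ 𝟙) X := eqm (tens1r X).
Definition runitV X : mor X (X ⊗ 𝟙) := eqm (esym (tens1r X)).

(* (A, e, c) is a left dual of B, equivalently (B, e, c) is a right dual of A. *)
Definition is_duality A B (e : mor (A ⊗ B) 𝟙) (c : mor 𝟙 (B ⊗ A)) :=
  lunit A ∘ (e ⊗ idm A) ∘ assocV A B A ∘ (idm A ⊗ c) ∘ runitV A = idm A
  /\ runit B ∘ (idm B ⊗ e) ∘ assoc B A B ∘ (c ⊗ idm B) ∘ lunitV B = idm B.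

Lemma eqm_id X (e : X = X) : eqm e = idm X.
Proof. by rewrite (proof_irrelevance _ e erefl). Qed.

Lemma eqm_irr X Y (e e' : X = Y) : eqm e = eqm e'.
Proof. by rewrite (proof_irrelevance _ e e'). Qed.

Lemma eqm_comp X Y Z (e : X = Y) (e' : Y = Z) :
  eqm e' ∘ eqm e = eqm (etrans e e').
Proof. by case: Z / e'; rewrite comp1m. Qed.

Lemma eqm_compA W X Y Z (e : X = Y) (e' : Y = Z) (f : mor W X) :
  eqm e' ∘ (eqm e ∘ f) = eqm (etrans e e') ∘ f.
Proof. by rewrite compA eqm_comp. Qed.

Lemma tensm_eqm X X' Y Y' (e : X = X') (e' : Y = Y') :
  eqm e ⊗ eqm e' = eqm (f_equal2 tens e e').
Proof. by case: X' / e; case: Y' / e'; rewrite [RHS]eqm_id -tensm1. Qed.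

Lemma eqm_tensl X X' Y (e : X = X') :
  eqm e ⊗ idm Y = eqm (f_equal2 tens e erefl).
Proof. exact: (tensm_eqm e erefl). Qed.

Lemma eqm_tensr X X' Y (e : X = X') :
  idm Y ⊗ eqm e = eqm (f_equal2 tens erefl e).
Proof. exact: (tensm_eqm erefl e). Qed.

Lemma castmE X X' Y Y' (eX : X = X') (eY : Y = Y') (f : mor X Y) :
  castm eX eY f ∘ eqm eX = eqm eY ∘ f.
Proof. by case: X' / eX; case: Y' / eY; rewrite /eqm /= compm1 comp1m. Qed.

Lemma assoc_nat X X' Y Y' Z Z' (f : mor X X') (g : mor Y Y') (h : mor Z Z') :
  assoc X' Y' Z' ∘ (f ⊗ g ⊗ h) = (f ⊗ (g ⊗ h)) ∘ assoc X Y Z.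
Proof. by rewrite -tensmA castmE. Qed.

Lemma lunit_nat X Y (f : mor X Y) : lunit Y ∘ (idm 𝟙 ⊗ f) = f ∘ lunit X.
Proof. by rewrite -[in RHS](tensm1l f) castmE. Qed.

Lemma runit_nat X Y (f : mor X Y) : runit Y ∘ (f ⊗ idm 𝟙) = f ∘ runit X.
Proof. by rewrite -[in RHS](tensm1r f) castmE. Qed.

Lemma assocV_nat X X' Y Y' Z Z' (f : mor X X') (g : mor Y Y') (h : mor Z Z') :
  assocV X' Y' Z' ∘ (f ⊗ (g ⊗ h)) = (f ⊗ g ⊗ h) ∘ assocV X Y Z.
Proof.
rewrite -[LHS]compm1 -(eqm_id (etrans (esym (tensA X Y Z)) (tensA X Y Z))).
rewrite -eqm_comp -/(assoc X Y Z) -/(assocV X Y Z) compA -(compA (assocV _ _ _)).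
by rewrite -assoc_nat compA eqm_comp eqm_id comp1m.
Qed.

Lemma runitV_nat X Y (f : mor X Y) : (f ⊗ idm 𝟙) ∘ runitV X = runitV Y ∘ f.
Proof.
rewrite -[LHS]comp1m -(eqm_id (etrans (tens1r Y) (esym (tens1r Y)))) -eqm_comp.
rewrite -/(runit Y) -/(runitV Y) -compA (compA (runit Y)) runit_nat -compA.
by rewrite eqm_comp eqm_id compm1.
Qed.

Section Transpose.
Variables (A B : C) (e : mor (A ⊗ B) 𝟙) (c : mor 𝟙 (B ⊗ A)).
Hypothesis dAB : is_duality e c.

(* Hom(Z ⊗ B, 𝟙) -> Hom(Z, A), inverse to f |-> e ∘ (f ⊗ B). *)
Definition transp Z (u : mor (Z ⊗ B) 𝟙) : mor Z A :=
  lunit A ∘ (u ⊗ idm A) ∘ assocV Z B A ∘ (idm Z ⊗ c) ∘ runitV Z.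

Let tensm_compl X Y W (D : C) (g : mor Y W) (f : mor X Y) :
  (g ∘ f) ⊗ idm D = (g ⊗ idm D) ∘ (f ⊗ idm D).
Proof. by rewrite -tensm_comp comp1m. Qed.

Let tensm_compr X Y W (D : C) (g : mor Y W) (f : mor X Y) :
  idm D ⊗ (g ∘ f) = (idm D ⊗ g) ∘ (idm D ⊗ f).
Proof. by rewrite -tensm_comp comp1m. Qed.

Let tensm_swap X X' Y Y' (f : mor X X') (g : mor Y Y') :
  (idm X' ⊗ g) ∘ (f ⊗ idm Y) = (f ⊗ idm Y') ∘ (idm X ⊗ g).
Proof. by rewrite -!tensm_comp !comp1m !compm1. Qed.

Lemma transpK Z (f : mor Z A) : transp (e ∘ (f ⊗ idm B)) = f.
Proof.
rewrite /transp tensm_compl (compA (lunit A)) -(compA _ (f ⊗ _ ⊗ _)).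
rewrite -assocV_nat tensm1 compA -(compA _ (f ⊗ _)) -tensm_swap compA.
rewrite -(compA _ (f ⊗ _)) runitV_nat compA.
by case: dAB => -> _; rewrite comp1m.
Qed.

Lemma transpE Z (u : mor (Z ⊗ B) 𝟙) : e ∘ (transp u ⊗ idm B) = u.
Proof.
rewrite /transp !tensm_compl.
have -> : lunit A ⊗ idm B = lunit (A ⊗ B) ∘ assoc 𝟙 A B.
  by rewrite /lunit /assoc eqm_comp eqm_tensl; apply: eqm_irr.
rewrite !compA -lunit_nat -(compA _ (assoc _ _ _)) assoc_nat tensm1 !compA.
rewrite -(compA (lunit 𝟙)) tensm_swap.
have -> : lunit 𝟙 = runit 𝟙 :> mor (𝟙 ⊗ 𝟙) (𝟙 : C) by apply: eqm_irr.
rewrite !compA runit_nat -!compA -[RHS]compm1; congr (u ∘ _).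
have -> : (idm Z ⊗ c) ⊗ idm B =
    assocV _ _ _ ∘ ((idm Z ⊗ (c ⊗ idm B)) ∘ assoc _ _ _).
  by rewrite -assoc_nat compA eqm_comp eqm_id comp1m.
have -> : idm (Z ⊗ B) ⊗ e =
    assocV _ _ _ ∘ ((idm Z ⊗ (idm B ⊗ e)) ∘ assoc _ _ _).
  by rewrite -assoc_nat compA eqm_comp eqm_id comp1m tensm1.
case: dAB => _ zz; rewrite -[RHS]tensm1 -[in RHS]zz !tensm_compr.
rewrite /assoc /assocV /runit /lunitV /runitV -!compA.
rewrite !eqm_tensl !eqm_tensr !eqm_compA !eqm_comp.
congr (_ ∘ _); first exact: eqm_irr.
congr (_ ∘ _); congr (_ ∘ _); first exact: eqm_irr.
congr (_ ∘ _); exact: eqm_irr.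
Qed.

End Transpose.
End Coherence.

(* For every X, (ev, coev) is a left duality and (evr, coevr) a right duality. *)
Record dualityCat := DualityCat {
  dc_cat :> strictMonCat;
  dual : dc_cat -> dc_cat;
  ev : forall X, mor (dual X ⊗ X) 𝟙;
  coev : forall X, mor 𝟙 (X ⊗ dual X);
  evr : forall X, mor (X ⊗ dual X) 𝟙;
  coevr : forall X, mor 𝟙 (dual X ⊗ X);
  left_duality : forall X, is_duality (ev X) (coev X);
  right_duality : forall X, is_duality (evr X) (coevr X)
}.
Arguments dual {d} X%_ob.
Arguments ev {d} X%_ob.
Arguments coev {d} X%_ob.
Arguments evr {d} X%_ob.
Arguments coevr {d} X%_ob.
Notation "X ^∨" := (dual X) (at level 2, format "X ^∨") : ob_scope.

Section DualFunctors.
Variable C : dualityCat.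
Implicit Types X Y : C.

Definition ldual X Y (f : mor X Y) : mor Y^∨ X^∨ :=
  lunit X^∨ ∘ (ev Y ⊗ idm X^∨) ∘ assocV Y^∨ Y X^∨ ∘ (idm Y^∨ ⊗ (f ⊗ idm X^∨))
    ∘ (idm Y^∨ ⊗ coev X) ∘ runitV Y^∨.

Definition rdual X Y (f : mor X Y) : mor Y^∨ X^∨ :=
  runit X^∨ ∘ (idm X^∨ ⊗ evr Y) ∘ assoc X^∨ Y Y^∨ ∘ (idm X^∨ ⊗ f ⊗ idm Y^∨)
    ∘ (coevr X ⊗ idm Y^∨) ∘ lunitV Y^∨.

(* Monoidal constraints of the two dual functors:
   Y^∨ ⊗ X^∨ -> (X ⊗ Y)^∨ and 𝟙 -> 𝟙^∨. *)
Definition ldual_tens X Y : mor (Y^∨ ⊗ X^∨) (X ⊗ Y)^∨ :=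
  let D := (X ⊗ Y)^∨ in
  lunit D ∘ (ev Y ⊗ idm D) ∘ assocV Y^∨ Y D
    ∘ (idm Y^∨ ⊗ (lunit (Y ⊗ D) ∘ (ev X ⊗ idm (Y ⊗ D)) ∘ assocV X^∨ X (Y ⊗ D)
                    ∘ (idm X^∨ ⊗ assoc X Y D)))
    ∘ assoc Y^∨ X^∨ (X ⊗ Y ⊗ D)
    ∘ (idm (Y^∨ ⊗ X^∨) ⊗ coev (X ⊗ Y)) ∘ runitV (Y^∨ ⊗ X^∨).

Definition rdual_tens X Y : mor (Y^∨ ⊗ X^∨) (X ⊗ Y)^∨ :=
  let D := (X ⊗ Y)^∨ in
  runit D ∘ (idm D ⊗ evr X) ∘ assoc D X X^∨
    ∘ ((runit (D ⊗ X) ∘ (idm (D ⊗ X) ⊗ evr Y) ∘ assoc (D ⊗ X) Y Y^∨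
          ∘ (assocV D X Y ⊗ idm Y^∨)) ⊗ idm X^∨)
    ∘ assocV (D ⊗ (X ⊗ Y)) Y^∨ X^∨
    ∘ (coevr (X ⊗ Y) ⊗ idm (Y^∨ ⊗ X^∨)) ∘ lunitV (Y^∨ ⊗ X^∨).

Definition ldual_one : mor (𝟙 : C) 𝟙^∨ := lunit 𝟙^∨ ∘ coev 𝟙.
Definition rdual_one : mor (𝟙 : C) 𝟙^∨ := runit 𝟙^∨ ∘ coevr 𝟙.

End DualFunctors.

Record pivotalCat := PivotalCat {
  pc_dc :> dualityCat;
  ldual_rdual : forall (X Y : pc_dc) (f : mor X Y), ldual f = rdual f;
  ldual_rdual_tens : forall X Y : pc_dc, ldual_tens X Y = rdual_tens X Y;
  ldual_rdual_one : ldual_one pc_dc = rdual_one pc_dc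
}.

Section Pivotal.
Variable C : pivotalCat.
Implicit Types X Y Z : C.

Definition piv X : mor X X^∨^∨ :=
  lunit X^∨^∨ ∘ (evr X ⊗ idm X^∨^∨) ∘ assocV X X^∨ X^∨^∨
    ∘ (idm X ⊗ coev X^∨) ∘ runitV X.

(* Inverse of [piv X]: see [pivK] and [pivVK] below. *)
Definition pivV X : mor X^∨^∨ X :=
  lunit X ∘ (ev X^∨ ⊗ idm X) ∘ assocV X^∨^∨ X^∨ X
    ∘ (idm X^∨^∨ ⊗ coevr X) ∘ runitV X^∨^∨.

Lemma pivK X : pivV X ∘ piv X = idm X.
Proof.
have dl := left_duality X^∨; have dr := right_duality X.
rewrite -[LHS](transpK dr) -[RHS](transpK dr); congr transp.
rewrite -[X in _ ⊗ X](comp1m (idm _)) tensm_comp compA.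
by rewrite (transpE dr) (transpE dl) tensm1 compm1.
Qed.

Lemma pivVK X : piv X ∘ pivV X = idm X^∨^∨.
Proof.
have dl := left_duality X^∨; have dr := right_duality X.
rewrite -[LHS](transpK dl) -[RHS](transpK dl); congr transp.
rewrite -[X in _ ⊗ X](comp1m (idm _)) tensm_comp compA.
by rewrite (transpE dl) (transpE dr) tensm1 compm1.
Qed.

Definition ptrl X Y Z (f : mor (X ⊗ Y) (X ⊗ Z)) : mor Y Z :=
  lunit Z ∘ (ev X ⊗ idm Z) ∘ assocV X^∨ X Z ∘ (idm X^∨ ⊗ f) ∘ assoc X^∨ X Y
    ∘ (coevr X ⊗ idm Y) ∘ lunitV Y.

Definition ptrr X Y Z (g : mor (Y ⊗ X) (Z ⊗ X)) : mor Y Z :=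
  runit Z ∘ (idm Z ⊗ evr X) ∘ assoc Z X X^∨ ∘ (g ⊗ idm X^∨) ∘ assocV Y X X^∨
    ∘ (idm Y ⊗ coev X) ∘ runitV Y.

Definition retract (U X : C) :=
  exists (p : mor X U) (q : mor U X), p ∘ q = idm U.

Definition is_left_ideal (I : C -> Prop) :=
  (forall U X, I X -> retract U X -> I U) /\ (forall X Y, I X -> I (Y ⊗ X)%ob).
Definition is_right_ideal (I : C -> Prop) :=
  (forall U X, I X -> retract U X -> I U) /\ (forall X Y, I X -> I (X ⊗ Y)%ob).

Definition left_ideal_gen (O : C -> Prop) (U : C) :=
  exists X Y, O X /\ retract U (Y ⊗ X).
Definition right_ideal_gen (O : C -> Prop) (U : C) :=
  exists X Z, O X /\ retract U (X ⊗ Z).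

Lemma retract_eq X Y : X = Y -> retract X Y.
Proof. by move=> <-; exists (idm X), (idm X); rewrite comp1m. Qed.

Lemma retract_trans X Y Z : retract X Y -> retract Y Z -> retract X Z.
Proof.
move=> [p [q pq]] [p' [q' pq']]; exists (p ∘ p'), (q' ∘ q).
by rewrite -compA (compA p') pq' comp1m.
Qed.

Lemma retract_tens X X' Y Y' :
  retract X X' -> retract Y Y' -> retract (X ⊗ Y) (X' ⊗ Y').
Proof.
move=> [p [q pq]] [p' [q' pq']]; exists (p ⊗ p'), (q ⊗ q').
by rewrite -tensm_comp pq pq' tensm1.
Qed.

Lemma left_ideal_genP O : is_left_ideal (left_ideal_gen O).
Proof.
split=> [U V [X [Y [OX rV]]] rU|V W [X [Y [OX rV]]]].
  by exists X, Y; split=> //; apply: retract_trans rV.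
exists X, (W ⊗ Y)%ob; split=> //; rewrite tensA.
by apply: retract_tens => //; apply: retract_eq.
Qed.

Lemma right_ideal_genP O : is_right_ideal (right_ideal_gen O).
Proof.
split=> [U V [X [Y [OX rV]]] rU|V W [X [Y [OX rV]]]].
  by exists X, Y; split=> //; apply: retract_trans rV.
exists X, (Y ⊗ W)%ob; split=> //; rewrite -tensA.
by apply: retract_tens => //; apply: retract_eq.
Qed.

Lemma sub_left_ideal_gen O X : O X -> left_ideal_gen O X.
Proof.
move=> OX; exists X, 𝟙%ob; split=> //.
by apply: retract_eq; rewrite tens1l.
Qed.

Lemma sub_right_ideal_gen O X : O X -> right_ideal_gen O X.
Proof.
move=> OX; exists X, 𝟙%ob; split=> //.
by apply: retract_eq; rewrite tens1r.
Qed.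

End Pivotal.

Record linPivotalCat (R : comPzRingType) := LinPivotalCat {
  lc_cat :> pivotalCat;
  lc_class : forall X Y : lc_cat, GRing.Lmodule R (mor X Y)
}.

HB.instance Definition _ (R : comPzRingType) (C : linPivotalCat R) (X Y : C) :=
  lc_class X Y.

Record pivotalKCat (R : comPzRingType) := PivotalKCat {
  kc_cat :> linPivotalCat R;
  comp_linear_l : forall (X Y Z : kc_cat) (f : mor X Y),
    linear (fun g : mor Y Z => g ∘ f : mor X Z);
  comp_linear_r : forall (X Y Z : kc_cat) (g : mor Y Z),
    linear (fun f : mor X Y => g ∘ f : mor X Z);
  tensm_linear_l : forall (X X' Y Y' : kc_cat) (g : mor Y Y'),
    linear (fun f : mor X X' => f ⊗ g : mor (X ⊗ Y) (X' ⊗ Y'));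
  tensm_linear_r : forall (X X' Y Y' : kc_cat) (f : mor X X'),
    linear (fun g : mor Y Y' => f ⊗ g : mor (X ⊗ Y) (X' ⊗ Y'));
  (* End(𝟙) is free of rank one, with basis e *)
  end_one_free : exists e : mor (𝟙 : kc_cat) 𝟙,
    bijective (fun a : R => a *: e)
}.

Section Traces.
Variables (R : comPzRingType) (C : pivotalKCat R).

(* A class of objects is a predicate on objects; families indexed by a class
   take a membership proof. *)
Definition end_family (O : C -> Prop) :=
  forall X : C, O X -> mor X X -> R.

Definition linear_family (O : C -> Prop) (t : end_family O) :=
  forall (X : C) (OX : O X), scalar (t X OX).

Definition restrict (I O : C -> Prop) (OI : forall X, O X -> I X)
    (t : end_family I) : end_family O :=
  fun X OX => t X (OI X OX).

Definition cyclic_family (I : C -> Prop) (t : end_family I) :=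
  forall (U V : C) (IU : I U) (IV : I V) (g : mor U V) (h : mor V U),
    t V IV (g ∘ h) = t U IU (h ∘ g).

Definition is_left_trace (I : C -> Prop) (t : end_family I) :=
  [/\ linear_family t, cyclic_family t &
    forall (X Y : C) (IX : I X) (IYX : I (Y ⊗ X)%ob) (f : mor (Y ⊗ X) (Y ⊗ X)),
      t (Y ⊗ X)%ob IYX f = t X IX (ptrl f)].

Definition is_right_trace (I : C -> Prop) (t : end_family I) :=
  [/\ linear_family t, cyclic_family t &
    forall (X Z : C) (IX : I X) (IXZ : I (X ⊗ Z)%ob) (f : mor (X ⊗ Z) (X ⊗ Z)),
      t (X ⊗ Z)%ob IXZ f = t X IX (ptrr f)].

Definition left_ambidextrous (O : C -> Prop) (t : end_family O) :=
  linear_family t /\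
  forall (X X' : C) (OX : O X) (OX' : O X') (f : mor (X' ⊗ X^∨) (X' ⊗ X^∨)),
    t X OX (pivV X ∘ ldual (ptrl f) ∘ piv X) = t X' OX' (ptrr f).

Definition right_ambidextrous (O : C -> Prop) (t : end_family O) :=
  linear_family t /\
  forall (X X' : C) (OX : O X) (OX' : O X') (g : mor (X^∨ ⊗ X') (X^∨ ⊗ X')),
    t X OX (pivV X ∘ ldual (ptrr g) ∘ piv X) = t X' OX' (ptrl g).

End Traces.

(* Main.v *)
From HB Require Import structures.
From mathcomp Require Import all_boot all_order all_algebra.
From Stdlib Require Import ProofIrrelevance FunctionalExtensionality.
From Stdlib Require Import IndefiniteDescription.
Require Import Defs.

(** Write a retract U of Y ⊗ X, with X in O, as p : Y ⊗ X -> U and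
    q : U -> Y ⊗ X with p ∘ q = id.  A left trace T extending t must satisfy
      T_U(f) = T_U(f p q) = T_{Y ⊗ X}(q f p) = t_X(tr_l^Y(q f p)),
    whence uniqueness ([left_trace_uniq]), and this formula is the definition of
    the extension ([gen_trace]).  That it does not depend on X, Y, p, q, and that
    it is cyclic, are both instances of one identity ([ambi_cyclic]):
      t_X(tr_l^Y(h g)) = t_{X'}(tr_l^{Y'}(g h))
    for g : Y ⊗ X -> Y' ⊗ X' and h : Y' ⊗ X' -> Y ⊗ X with X, X' in O.

    To get it from ambidexterity, put W = Y' ⊗ X' and let
      bend g h : W ⊗ X^* -> Y ⊗ X ⊗ X^* -> Y -> Y ⊗ X ⊗ X^* -> W ⊗ X^*
    apply h, absorb X ⊗ X^* by an evaluation, create it again by a coevaluation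
    and apply g.  Closing the strand X^* on the right reconnects g and h, so
    tr_r(bend g h) = g h ([ptrr_bend]).  Closing W on the left leaves an
    endomorphism of X^*, and sliding h around the W-loop turns it into the dual
    of tr_l^Y(h g) ([ptrl_bend]).  Ambidexterity applied to
    tr_l^{Y'}(bend g h), an endomorphism of X' ⊗ X^*, is then the identity.

    Sliding h around a loop means that rotating h by a full turn to the left or
    to the right gives the same morphism ([rotation]): this is where the left
    and right dual functors have to agree as monoidal functors.  The same
    agreement makes the partial trace multiplicative in the traced object
    ([ptrl_tens], [ptrl_one]), which gives the compatibility of [gen_trace] with
    partial traces and its agreement with t on O.

    The diagrams are computed without associators by letting every morphism act
    on a spectator object Z to its right and nesting tensor products to the
    right: a coevaluation is a family Z -> A ⊗ (B ⊗ Z), natural in Z, and then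
    whiskering by an object on the right is instantiation of Z.

    Right traces are left traces in the category with the reversed tensor
    product, where the two dualities of an object are exchanged. *)

Set Implicit Arguments.
Unset Strict Implicit.
Unset Printing Implicit Defensive.
Import GRing.Theory.
Local Open Scope ring_scope.
Local Open Scope ob_scope.
Local Open Scope mor_scope.

Notation "X ◁ f" := (idm X ⊗ f)
  (at level 40, f at level 40, right associativity) : mor_scope.

(** * Equality of morphisms up to strictness *)

Section Coh.
Variable C : strictMonCat.
Implicit Types X Y Z W A B D : C.

(** Packing a morphism with its endpoints turns equality up to transport into
    plain equality: on packed morphisms the tensor product is associative and
    unital on the nose, and the morphisms [eqm e] can be erased. *)
Definition tot X Y (f : mor X Y) : {X & {Y & mor X Y}} :=
  existT _ X (existT _ Y f).

Lemma tot_inj X Y (f g : mor X Y) : tot f = tot g -> f = g.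
Proof.
by move=> e; exact: EqdepTheory.inj_pair2 (EqdepTheory.inj_pair2 _ _ _ _ _ e).
Qed.

Lemma tot_castm X X' Y Y' (eX : X = X') (eY : Y = Y') (f : mor X Y) :
  tot (castm eX eY f) = tot f.
Proof. by case: X' / eX; case: Y' / eY. Qed.

Lemma tot_eqm X Y (e : X = Y) : tot (eqm e) = tot (idm X).
Proof. by case: Y / e. Qed.

Lemma tot_eqml X Y Z (e : Y = Z) (f : mor X Y) : tot (eqm e ∘ f) = tot f.
Proof. by case: Z / e; rewrite comp1m. Qed.

Lemma tot_eqmr X Y Z (e : X = Y) (f : mor Y Z) : tot (f ∘ eqm e) = tot f.
Proof. by case: Y / e f => f; rewrite compm1. Qed.

Lemma tot_comp X Y Z X' Y' Z' (g : mor Y Z) (f : mor X Y)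
  (g' : mor Y' Z') (f' : mor X' Y') :
  tot g = tot g' -> tot f = tot f' -> tot (g ∘ f) = tot (g' ∘ f').
Proof.
move=> eg ef; have eX := EqdepFacts.eq_sigT_fst ef.
have eY := EqdepFacts.eq_sigT_fst eg.
case: X' / eX f' ef => f'; case: Y' / eY f' g' eg => f' g' eg ef.
have {}eg := EqdepTheory.inj_pair2 _ _ _ _ _ eg.
have eZ := EqdepFacts.eq_sigT_fst eg.
case: Z' / eZ g' eg => g' eg.
by rewrite (EqdepTheory.inj_pair2 _ _ _ _ _ eg) (tot_inj ef).
Qed.

Definition ttens (u v : {X & {Y & mor X Y}}) :=
  tot (projT2 (projT2 u) ⊗ projT2 (projT2 v)).

Lemma tot_tens X X' Y Y' (f : mor X X') (g : mor Y Y') :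
  tot (f ⊗ g) = ttens (tot f) (tot g).
Proof. by []. Qed.

Lemma ttensA u v w : ttens (ttens u v) w = ttens u (ttens v w).
Proof.
case: u v w => [X [X' f]] [Y [Y' g]] [Z [Z' h]].
by rewrite /ttens /= -tensmA tot_castm.
Qed.

Lemma ttens1l u : ttens (tot (idm (𝟙 : C))) u = u.
Proof.
case: u => [X [X' f]].
by rewrite /ttens /= -[RHS]/(tot f) -{2}(tensm1l f) tot_castm.
Qed.

Lemma ttens1r u : ttens u (tot (idm (𝟙 : C))) = u.
Proof.
case: u => [X [X' f]].
by rewrite /ttens /= -[RHS]/(tot f) -{2}(tensm1r f) tot_castm.
Qed.

Lemma tot_id_tens X Y : tot (idm (X ⊗ Y)) = ttens (tot (idm X)) (tot (idm Y)).
Proof. by rewrite -tot_tens tensm1. Qed.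

Lemma whiskl_comp X Y Z W (g : mor Y Z) (f : mor W Y) :
  X ◁ (g ∘ f) = (X ◁ g) ∘ (X ◁ f).
Proof. by rewrite -tensm_comp comp1m. Qed.

Lemma whiskr_comp X Y Z W (g : mor Y Z) (f : mor W Y) :
  (g ∘ f) ⊗ idm X = (g ⊗ idm X) ∘ (f ⊗ idm X).
Proof. by rewrite -tensm_comp comp1m. Qed.

End Coh.

(** * Diagrams acting on a spectator object *)

(** These families are locked so that reassociating a composite never looks
    inside them. *)
HB.lock Definition cup (C : strictMonCat) (A B : C) (c : mor 𝟙 (A ⊗ B)) (Z : C) :
    mor Z (A ⊗ (B ⊗ Z)) :=
  assoc A B Z ∘ (c ⊗ idm Z) ∘ lunitV Z.
HB.lock Definition cap (C : strictMonCat) (A B : C) (e : mor (A ⊗ B) 𝟙) (Z : C) :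
    mor (A ⊗ (B ⊗ Z)) Z :=
  lunit Z ∘ (e ⊗ idm Z) ∘ assocV A B Z.
HB.lock Definition reassoc (C : strictMonCat) (A B A' B' : C)
    (f : mor (A ⊗ B) (A' ⊗ B')) (Z : C) : mor (A ⊗ (B ⊗ Z)) (A' ⊗ (B' ⊗ Z)) :=
  assoc A' B' Z ∘ (f ⊗ idm Z) ∘ assocV A B Z.

(** [coh] proves equations between composites that differ only by associators
    and units: it distributes whiskering over composition, packs both sides,
    erases the identities [eqm e] and compares the remaining factors. *)
Ltac coh_unfold :=
  rewrite ?(cup.unlock, cap.unlock, reassoc.unlock)
    ?/assoc ?/assocV ?/lunit ?/lunitV ?/runit ?/runitV.
Ltac coh_distr :=
  rewrite ?(whiskl_comp, whiskr_comp); rewrite ?(tensm_eqm, eqm_tensl, eqm_tensr).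
Ltac coh_leaf :=
  by rewrite ?(tot_eqm, tot_tens, tot_id_tens, ttensA, ttens1l, ttens1r).
Ltac coh_strip :=
  rewrite -?compA ?eqm_comp ?(tot_eqml, tot_eqmr);
  match goal with
  | |- tot (_ ∘ _) = tot (_ ∘ _) => apply: tot_comp; [coh_leaf | coh_strip]
  | |- _ => coh_leaf
  end.
Ltac coh :=
  coh_unfold; apply: tot_inj; coh_distr; coh_distr; coh_distr; coh_strip.

Section Calc.
Variable C : strictMonCat.
Implicit Types X Y Z W A B D : C.

(** A morphism is determined by its action on the spectator 𝟙. *)
Lemma stab_inj X Y (f g : mor X Y) : f ⊗ idm 𝟙 = g ⊗ idm 𝟙 -> f = g.
Proof. by move=> e; rewrite -(tensm1r f) e tensm1r. Qed.

Lemma interchange X X' Y Y' (f : mor X X') (g : mor Y Y') :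
  (f ⊗ idm Y') ∘ (X ◁ g) = (X' ◁ g) ∘ (f ⊗ idm Y).
Proof. by rewrite -!tensm_comp !comp1m !compm1. Qed.

Lemma cap_nat A B (e : mor (A ⊗ B) 𝟙) Z Z' (f : mor Z Z') :
  cap e Z' ∘ (A ◁ (B ◁ f)) = f ∘ cap e Z.
Proof.
rewrite !cap.unlock -!compA assocV_nat tensm1 (compA (e ⊗ _)) interchange.
by rewrite -!compA compA lunit_nat -!compA.
Qed.

Lemma lunitV_nat X Y (f : mor X Y) : (𝟙%ob ◁ f) ∘ lunitV X = lunitV Y ∘ f.
Proof. by coh. Qed.

Lemma cup_nat A B (c : mor 𝟙 (A ⊗ B)) Z Z' (f : mor Z Z') :
  cup c Z' ∘ f = (A ◁ (B ◁ f)) ∘ cup c Z.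
Proof.
rewrite !cup.unlock -!compA -lunitV_nat (compA (c ⊗ _)) interchange -!compA compA.
by rewrite -tensm1 assoc_nat -!compA.
Qed.

Lemma assoc_natr X Y Z Z' (f : mor Z Z') :
  assoc X Y Z' ∘ (idm (X ⊗ Y) ⊗ f) = (X ◁ (Y ◁ f)) ∘ assoc X Y Z.
Proof. by rewrite -tensm1 assoc_nat. Qed.

Section Zigzag.
Variables (A B : C) (e : mor (A ⊗ B) 𝟙) (c : mor 𝟙 (B ⊗ A)).
Hypothesis dAB : is_duality e c.

Lemma zigl Z : cap e (A ⊗ Z) ∘ (A ◁ cup c Z) = idm (A ⊗ Z).
Proof.
case: dAB => zz _; rewrite -tensm1 -[in RHS]zz; coh.
Qed.

Lemma zigr Z : (B ◁ cap e Z) ∘ cup c (B ⊗ Z) = idm (B ⊗ Z).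
Proof.
case: dAB => _ zz; rewrite -tensm1 -[in RHS]zz; coh.
Qed.
End Zigzag.
End Calc.
(** * The left and right dual functors *)

Section Dual.
Variable C : dualityCat.
Implicit Types X Y Z W A B D : C.

Definition ev_zigl X Z := zigl (left_duality X) Z.
Definition ev_zigr X Z := zigr (left_duality X) Z.
Definition evr_zigl X Z := zigl (right_duality X) Z.

Lemma ldualZ X Y (f : mor X Y) Z : ldual f ⊗ idm Z =
  cap (ev Y) (X^∨ ⊗ Z) ∘ (Y^∨ ◁ (f ⊗ idm (X^∨ ⊗ Z))) ∘ (Y^∨ ◁ cup (coev X) Z).
Proof. rewrite /ldual; coh. Qed.

Lemma rdualZ X Y (f : mor X Y) Z : rdual f ⊗ idm Z =
  (X^∨ ◁ cap (evr Y) Z) ∘ (X^∨ ◁ (f ⊗ idm (Y^∨ ⊗ Z)))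
    ∘ cup (coevr X) (Y^∨ ⊗ Z).
Proof. rewrite /rdual; coh. Qed.

Lemma ldual_tensZ X Y Z : ldual_tens X Y ⊗ idm Z =
  let D := (X ⊗ Y)^∨ in
  cap (ev Y) (D ⊗ Z) ∘ (Y^∨ ◁ cap (ev X) (Y ⊗ (D ⊗ Z)))
   ∘ (Y^∨ ◁ (X^∨ ◁ (assoc X Y (D ⊗ Z) ∘ cup (coev (X ⊗ Y)) Z)))
   ∘ assoc Y^∨ X^∨ Z.
Proof. rewrite /ldual_tens /=; coh. Qed.

Lemma rdual_tensZ X Y Z : rdual_tens X Y ⊗ idm Z =
  let D := (X ⊗ Y)^∨ in
  (D ◁ (cap (evr X) Z ∘ (X ◁ cap (evr Y) (X^∨ ⊗ Z)) ∘ assoc X Y _))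
   ∘ cup (coevr (X ⊗ Y)) (Y^∨ ⊗ (X^∨ ⊗ Z)) ∘ assoc Y^∨ X^∨ Z.
Proof. rewrite /rdual_tens /=; coh. Qed.

Lemma ldual_oneZ Z :
  ldual_one C ⊗ idm Z = lunit (𝟙^∨ ⊗ Z) ∘ cup (coev 𝟙) Z ∘ lunit Z.
Proof. rewrite /ldual_one; coh. Qed.

Lemma rdual_oneZ Z :
  rdual_one C ⊗ idm Z = (𝟙^∨ ◁ lunit Z) ∘ cup (coevr 𝟙) Z ∘ lunit Z.
Proof. rewrite /rdual_one; coh. Qed.

Lemma ldual_cap X Y (f : mor X Y) Z :
  cap (ev X) Z ∘ (ldual f ⊗ idm (X ⊗ Z)) = cap (ev Y) Z ∘ (Y^∨ ◁ (f ⊗ idm Z)).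
Proof.
rewrite ldualZ !compA -cap_nat -!compA -!whiskl_comp (compA (Y ◁ _)) -interchange.
by rewrite -compA ev_zigr compm1.
Qed.

(** By the zigzag identities, sliding along the evaluation characterizes the
    dual morphism. *)
Lemma ldual_uniq X Y (f : mor X Y) (a : mor Y^∨ X^∨) :
  (forall Z, cap (ev X) Z ∘ (a ⊗ idm (X ⊗ Z))
               = cap (ev Y) Z ∘ (Y^∨ ◁ (f ⊗ idm Z))) ->
  a = ldual f.
Proof.
move=> H; apply: stab_inj.
rewrite ldualZ -H -compA interchange compA.
by rewrite ev_zigl comp1m.
Qed.

(** The three lemmas below say that the monoidal constraint identifies the
    duality of X ⊗ Y with the nested dualities of X and Y.  The left constraint
    transports [ev], the right one transports [evr] and [coevr]; only when the two
    constraints coincide do these describe a single identification. *)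
Lemma ldual_tens_cap X Y Z :
  cap (ev (X ⊗ Y)) Z ∘ (ldual_tens X Y ⊗ idm (X ⊗ Y ⊗ Z)) =
  cap (ev Y) Z ∘ (Y^∨ ◁ cap (ev X) (Y ⊗ Z)) ∘ (Y^∨ ◁ (X^∨ ◁ assoc X Y Z))
   ∘ assoc Y^∨ X^∨ (X ⊗ Y ⊗ Z).
Proof.
rewrite ldual_tensZ /= !compA -cap_nat -!compA; congr (_ ∘ _).
rewrite !compA -!whiskl_comp -cap_nat -!compA -whiskl_comp (compA (X ◁ _)) -assoc_natr.
by rewrite -compA ev_zigr compm1 whiskl_comp -compA.
Qed.

Lemma rdual_tens_cap X Y Z :
  cap (evr (X ⊗ Y)) Z ∘ ((X ⊗ Y) ◁ (rdual_tens X Y ⊗ idm Z)) =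
  cap (evr X) Z ∘ (X ◁ cap (evr Y) (X^∨ ⊗ Z)) ∘ assoc X Y _ ∘
  ((X ⊗ Y) ◁ assoc Y^∨ X^∨ Z).
Proof.
rewrite rdual_tensZ /= -!compA whiskl_comp compA cap_nat -!compA.
by rewrite whiskl_comp (compA (cap (evr (X ⊗ Y)) _)) evr_zigl comp1m.
Qed.

Lemma rdual_tens_cup X Y Z :
  cup (coevr (X ⊗ Y)) Z =
  (rdual_tens X Y ⊗ idm (X ⊗ Y ⊗ Z)) ∘ assocV _ _ _ ∘
   (Y^∨ ◁ (X^∨ ◁ assocV X Y Z)) ∘ (Y^∨ ◁ cup (coevr X) (Y ⊗ Z)) ∘ cup (coevr Y) Z.
Proof.
have assocK A B D : assoc A B D ∘ assocV A B D = idm (A ⊗ (B ⊗ D)) :> mor _ _.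
  by rewrite eqm_comp eqm_id.
have assocVK A B D : assocV A B D ∘ assoc A B D = idm (A ⊗ B ⊗ D) :> mor _ _.
  by rewrite eqm_comp eqm_id.
rewrite rdual_tensZ /= -!compA (compA (assoc _ _ _) (assocV _ _ _)).
rewrite assocK comp1m.
(* Slide both nested coevaluations into the constraint, where they cancel
   against the nested evaluations. *)
rewrite (compA (Y^∨ ◁ _)) -whiskl_comp cup_nat compA -whiskl_comp -!compA.
rewrite assoc_natr (compA (X ◁ _)) -whiskl_comp.
rewrite (whiskl_comp Y) (compA (cap (evr Y) _)) cap_nat -(compA _ (cap (evr Y) _)).
rewrite evr_zigl compm1 (whiskl_comp X) -(compA (X ◁ _)).
rewrite (compA (cap (evr X) _)) cap_nat.
rewrite -(compA _ (cap (evr X) _)) (compA (cap (evr X) _)) evr_zigl comp1m.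
by rewrite assocVK tensm1 comp1m.
Qed.

End Dual.

(** * Rotation invariance *)

HB.lock Definition fork (C : strictMonCat) (W Y X : C)
    (h : mor W (Y ⊗ X)) (Z : C) :
  mor (W ⊗ Z) (Y ⊗ (X ⊗ Z)) := assoc Y X Z ∘ (h ⊗ idm Z).
HB.lock Definition join (C : strictMonCat) (W Y X : C)
    (g : mor (Y ⊗ X) W) (Z : C) :
  mor (Y ⊗ (X ⊗ Z)) (W ⊗ Z) := (g ⊗ idm Z) ∘ assocV Y X Z.

Section Fork.
Variable C : strictMonCat.
Implicit Types X Y Z W A B D : C.

Lemma fork_nat W Y X (h : mor W (Y ⊗ X)) Z Z' (k : mor Z Z') :
  fork h Z' ∘ (W ◁ k) = (Y ◁ (X ◁ k)) ∘ fork h Z.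
Proof. by rewrite !fork.unlock -compA interchange compA assoc_natr compA. Qed.

Lemma join_nat W Y X (g : mor (Y ⊗ X) W) Z Z' (k : mor Z Z') :
  join g Z' ∘ (Y ◁ (X ◁ k)) = (W ◁ k) ∘ join g Z.
Proof. by rewrite !join.unlock -compA assocV_nat tensm1 !compA interchange. Qed.

Lemma fork_join W Y X (h : mor W (Y ⊗ X)) (g : mor (Y ⊗ X) W) Z :
  fork h Z ∘ join g Z = reassoc (h ∘ g) Z.
Proof. rewrite fork.unlock join.unlock; coh. Qed.

Lemma join_fork W Y X (h : mor W (Y ⊗ X)) (g : mor (Y ⊗ X) W) Z :
  join g Z ∘ fork h Z = (g ∘ h) ⊗ idm Z.
Proof. rewrite fork.unlock join.unlock; coh. Qed.
End Fork.

Section Piv.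
Variable C : pivotalCat.
Implicit Types X Y Z W A B D : C.

Lemma assoc_epi X Y Z W (f g : mor (X ⊗ (Y ⊗ Z)) W) :
  f ∘ assoc X Y Z = g ∘ assoc X Y Z -> f = g.
Proof.
move=> /(congr1 (fun k => k ∘ assocV X Y Z)).
by rewrite -!compA eqm_comp eqm_id !compm1.
Qed.

(** On the left-hand side the two output legs of h are bent to the left, against
    the duals X^∨ and Y^∨ placed before W.  On the right-hand side a new pair
    W^∨ ⊗ W is created, h is applied to it with its output legs bent to the right
    against the same duals, and W^∨ is closed against the original W.  Both sides
    compute [ev W] applied to the dual of h: the left one through [ldual], the
    right one through [rdual]. *)
Lemma rotation W X Y (h : mor W (Y ⊗ X)) Z :
  cap (ev X) Z ∘ (X^∨ ◁ cap (ev Y) (X ⊗ Z))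
    ∘ (X^∨ ◁ (Y^∨ ◁ fork h Z)) =
  let V := (X^∨ ⊗ (Y^∨ ⊗ (W ⊗ Z)))%ob in
  cap (ev W) Z
    ∘ (W^∨ ◁ (cap (evr Y) (W ⊗ Z) ∘ (Y ◁ cap (evr X) (Y^∨ ⊗ (W ⊗ Z)))
              ∘ fork h V))
    ∘ cup (coevr W) V.
Proof.
rewrite !fork.unlock; apply: assoc_epi => /=.
transitivity (cap (ev W) Z ∘ (rdual h ⊗ idm (W ⊗ Z))
                ∘ (ldual_tens Y X ⊗ idm (W ⊗ Z))).
  rewrite -ldual_rdual ldual_cap -[RHS]compA -interchange [RHS]compA.
  by rewrite ldual_tens_cap -!compA assoc_natr !whiskl_comp -!compA.
rewrite ldual_rdual_tens rdualZ -!compA cup_nat !whiskl_comp -!compA.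
congr (_ ∘ _).
rewrite (compA (W^∨ ◁ (h ⊗ _))) -whiskl_comp interchange whiskl_comp -!compA.
rewrite (compA (W^∨ ◁ cap _ _)) -whiskl_comp rdual_tens_cap cup_nat.
rewrite !whiskl_comp -!compA (compA (W^∨ ◁ (h ⊗ _))) -(whiskl_comp _ (h ⊗ _)).
by rewrite interchange whiskl_comp -!compA.
Qed.

Lemma coevr_one_cup Z :
  cup (coevr (𝟙 : C)) Z = (ldual_one C ⊗ idm (𝟙 ⊗ Z)) ∘ lunitV _ ∘ lunitV Z.
Proof. by rewrite ldual_rdual_one rdual_oneZ; coh. Qed.

Lemma ev_one_cap Z :
  cap (ev (𝟙 : C)) Z ∘ (ldual_one C ⊗ idm (𝟙 ⊗ Z)) = lunit Z ∘ lunit _.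
Proof.
rewrite ldual_oneZ.
by rewrite !compA -(lunit_nat (cap _ _)) -(compA (lunit Z)) ev_zigr compm1.
Qed.

(** * Partial traces and the pivotal structure *)

Lemma ptrlE X Y Z (f : mor (X ⊗ Y) (X ⊗ Z)) :
  ptrl f = cap (ev X) Z ∘ (X^∨ ◁ f) ∘ cup (coevr X) Y.
Proof. by rewrite /ptrl; coh. Qed.

Lemma ptrlZ X Y Z (f : mor (X ⊗ Y) (X ⊗ Z)) W :
  ptrl f ⊗ idm W = cap (ev X) (Z ⊗ W) ∘ (X^∨ ◁ reassoc f W) ∘ cup (coevr X) (Y ⊗ W).
Proof. by rewrite /ptrl; coh. Qed.

Lemma ptrrZ X Y Z (f : mor (Y ⊗ X) (Z ⊗ X)) W :
  ptrr f ⊗ idm W = (Z ◁ cap (evr X) W) ∘ reassoc f (X^∨ ⊗ W) ∘ (Y ◁ cup (coev X) W).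
Proof. by rewrite /ptrr; coh. Qed.

Lemma pivZ X Z :
  piv X ⊗ idm Z = cap (evr X) (X^∨^∨ ⊗ Z) ∘ (X ◁ cup (coev X^∨) Z).
Proof. by rewrite /piv; coh. Qed.

Lemma pivVZ X Z :
  pivV X ⊗ idm Z = cap (ev X^∨) (X ⊗ Z) ∘ (X^∨^∨ ◁ cup (coevr X) Z).
Proof. by rewrite /pivV; coh. Qed.

Lemma ptrl_nat X Y Z Y' Z' (f : mor (X ⊗ Y) (X ⊗ Z)) (u : mor Y' Y) (v : mor Z Z') :
  v ∘ ptrl f ∘ u = ptrl ((X ◁ v) ∘ f ∘ (X ◁ u)).
Proof. by rewrite !ptrlE -!compA cup_nat !compA -cap_nat !whiskl_comp !compA. Qed.

(** The loop around X ⊗ Y uses [coevr] and [ev]; replacing its dual by Y^∨ ⊗ X^∨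
    introduces the right constraint in the first and removes the left one in the
    second, so the two have to be equal. *)
Lemma ptrl_tens X Y A B (f : mor (X ⊗ (Y ⊗ A)) (X ⊗ (Y ⊗ B))) :
  ptrl (ptrl f) = ptrl (assocV X Y B ∘ f ∘ assoc X Y A).
Proof.
have assocK U V W : assoc U V W ∘ assocV U V W = idm (U ⊗ (V ⊗ W)) :> mor _ _.
  by rewrite eqm_comp eqm_id.
rewrite [RHS]ptrlE rdual_tens_cup -ldual_rdual_tens !compA -(compA (cap _ _)).
rewrite -interchange compA ldual_tens_cap -!compA (compA (assoc _ _ _)).
rewrite assoc_natr.
rewrite -!compA (compA (assoc _ _ _) (assocV _ _ _)) assocK comp1m !ptrlE.
rewrite !whiskl_comp -!compA; congr (_ ∘ (_ ∘ _)).
rewrite (compA (Y^∨ ◁ (X^∨ ◁ assoc _ _ _))) -!whiskl_comp.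
rewrite assocK !tensm1 comp1m (compA (Y^∨ ◁ (X^∨ ◁ assoc _ _ _))) -!whiskl_comp.
by rewrite assocK !tensm1 comp1m.
Qed.

Lemma ptrl_one A B (f : mor (𝟙 ⊗ A) (𝟙 ⊗ B)) :
  ptrl f = lunit B ∘ f ∘ lunitV A.
Proof.
rewrite ptrlE coevr_one_cup !compA -(compA (cap _ _)) -interchange compA.
rewrite ev_one_cap -(compA (lunit _) (lunit _)) lunit_nat -!compA.
by rewrite (compA (lunit _) (lunitV _)) eqm_comp eqm_id comp1m.
Qed.

(** The inverse of the pivotal structure is defined from [ev] and [coevr]; the
    mirror formula, from [coev] and [evr], gives the same morphism.  It is the case
    h = [coev X] of [rotation], where the loop around 𝟙 disappears. *)
Lemma pivV_alt X Z :
  (X ◁ cap (evr X^∨) Z) ∘ cup (coev X) (X^∨^∨ ⊗ Z) = pivV X ⊗ idm Z.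
Proof.
have E T : cap (ev X^∨) T =
    cap (evr X) T ∘ ((X ◁ cap (evr X^∨) (X^∨ ⊗ T))
                       ∘ cup (coev X) (X^∨^∨ ⊗ (X^∨ ⊗ T))).
  have /= := congr1 (fun k => k ∘ (X^∨^∨ ◁ (X^∨ ◁ lunitV T)))
                    (rotation (coev X) T).
  have -> : fork (coev X) T = cup (coev X) T ∘ lunit T.
    by rewrite fork.unlock; coh.
  rewrite -ptrlE ptrl_one -!compA -!whiskl_comp -!compA eqm_comp eqm_id compm1 ev_zigl.
  rewrite tensm1 compm1 => ->.
  rewrite -lunitV_nat (compA (fork _ _)) fork_nat.
  rewrite !compA -(compA _ (X ◁ cap _ _)) -whiskl_comp cap_nat whiskl_comp !compA.
  rewrite -(compA _ (cap (evr X) _)) cap_nat !compA eqm_comp eqm_id comp1m -!compA.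
  congr (_ ∘ (_ ∘ _)).
  by rewrite fork.unlock; coh.
rewrite pivVZ E -!compA cup_nat (compA (X ◁ _)) -whiskl_comp cap_nat.
by rewrite whiskl_comp -!compA compA evr_zigl comp1m.
Qed.

Lemma pivV_alt_piv X Z :
  (X ◁ cap (evr X^∨) Z) ∘ cup (coev X) (X^∨^∨ ⊗ Z)
    ∘ (cap (evr X) (X^∨^∨ ⊗ Z) ∘ (X ◁ cup (coev X^∨) Z)) = idm (X ⊗ Z).
Proof. by rewrite pivV_alt -pivZ -whiskr_comp pivK tensm1. Qed.

Definition bend W Y X (g : mor (Y ⊗ X) W) (h : mor W (Y ⊗ X)) :
    mor (W ⊗ X^∨) (W ⊗ X^∨) :=
  (g ⊗ idm X^∨) ∘ assocV Y X X^∨ ∘ (Y ◁ (coev X ∘ evr X)) ∘ assoc Y X X^∨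
    ∘ (h ⊗ idm X^∨).

Lemma reassoc_bend W Y X (g : mor (Y ⊗ X) W) (h : mor W (Y ⊗ X)) Z :
  reassoc (bend g h) Z = join g (X^∨ ⊗ Z) ∘ (Y ◁ cup (coev X) Z)
    ∘ (Y ◁ cap (evr X) Z) ∘ fork h (X^∨ ⊗ Z).
Proof. rewrite /bend fork.unlock join.unlock; coh. Qed.

(** The four arcs joining X to X^∨ and X^∨^∨ form the pivotal isomorphism
    followed by its inverse, so g and h are reconnected by an identity strand. *)
Lemma ptrr_bend W Y X (g : mor (Y ⊗ X) W) (h : mor W (Y ⊗ X)) :
  ptrr (bend g h) = g ∘ h.
Proof.
apply: stab_inj; rewrite ptrrZ reassoc_bend -!compA fork_nat !compA -join_nat.
rewrite -join_fork -!compA; congr (_ ∘ _); rewrite !compA -!whiskl_comp -!compA.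
by rewrite (compA (X ◁ _)) pivV_alt_piv tensm1 comp1m.
Qed.

(** Both sides are compared through [ev X].  On the left, [ev X] cancels the
    coevaluation inside [bend g h].  On the right, [rotation] trades the arcs
    closing X and Y for a loop around W, after which the Y-strand straightens.
    Both give the loop around W that contains h, an evaluation of X, and g. *)
Lemma ptrl_bend W Y X (g : mor (Y ⊗ X) W) (h : mor W (Y ⊗ X)) :
  ptrl (bend g h) = ldual (ptrl (h ∘ g)).
Proof.
apply: ldual_uniq => Z; rewrite !ptrlZ reassoc_bend -fork_join.
transitivity (cap (ev W) Z ∘ (W^∨ ◁ (join g Z ∘ (Y ◁ cap (evr X) (X ⊗ Z))
   ∘ fork h (X^∨ ⊗ (X ⊗ Z)))) ∘ cup (coevr W) (X^∨ ⊗ (X ⊗ Z))).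
  rewrite !compA -cap_nat -(compA (cap (ev W) _)) -whiskl_comp !compA -join_nat.
  by rewrite -(compA (join g Z)) -whiskl_comp ev_zigr tensm1 compm1.
rewrite !(whiskl_comp X^∨) !(whiskl_comp Y^∨) !(whiskl_comp X^∨) !compA rotation /=.
rewrite -!compA -(whiskl_comp X^∨) cup_nat (compA (W^∨ ◁ _)) -(whiskl_comp W^∨).
congr (_ ∘ ((_ ◁ _) ∘ _)).
rewrite -!compA fork_nat (compA (Y ◁ cap _ _)) -(whiskl_comp Y) cap_nat.
rewrite (whiskl_comp Y) -!compA (whiskl_comp Y) -!compA (compA (cap _ _)).
by rewrite cap_nat -!compA (compA (cap (evr Y) _)) evr_zigl comp1m.
Qed.

Lemma cap_piv X T :
  cap (ev X^∨) T ∘ (piv X ⊗ idm (X^∨ ⊗ T)) = cap (evr X) T.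
Proof. by rewrite pivZ !compA -cap_nat -compA -whiskl_comp ev_zigr tensm1 compm1. Qed.

Lemma rdual_cap X Y (f : mor X Y) Z :
  cap (evr X) Z ∘ (X ◁ (rdual f ⊗ idm Z)) = cap (evr Y) Z ∘ (f ⊗ idm _).
Proof.
by rewrite rdualZ whiskl_comp compA -whiskl_comp cap_nat -compA evr_zigl compm1.
Qed.

Lemma piv_nat X Y (f : mor X Y) : piv Y ∘ f = ldual (ldual f) ∘ piv X.
Proof.
apply: stab_inj.
rewrite (whiskr_comp _ (piv Y) f) (whiskr_comp _ (ldual (ldual f)) (piv X)).
rewrite ldualZ -!compA.
rewrite (compA (X^∨^∨ ◁ _)) -whiskl_comp -interchange compA cap_piv whiskl_comp compA.
by rewrite ldual_rdual rdual_cap pivZ -!compA interchange.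
Qed.

(** Loops closed on opposite sides do not interact. *)
Lemma ptrr_ptrl X A A' B (k : mor (X ⊗ (A ⊗ B)) (X ⊗ (A' ⊗ B))) :
  ptrr (ptrl k) = ptrl (ptrr (assocV X A' B ∘ k ∘ assoc X A B)).
Proof.
have E T : reassoc (ptrl k) T = cap (ev X) _
    ∘ (X^∨ ◁ ((X ◁ assoc A' B T) ∘ reassoc k T ∘ (X ◁ assocV A B T)))
    ∘ cup (coevr X) _.
  by rewrite /ptrl; coh.
apply: stab_inj; rewrite ptrrZ ptrlZ E !compA -cap_nat -compA cup_nat !compA.
rewrite -!compA (compA (X^∨ ◁ _)) -whiskl_comp (compA (X^∨ ◁ _)) -whiskl_comp.
congr (_ ∘ (_ ∘ _)); congr (_ ◁ _).
by rewrite /ptrr; coh.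
Qed.
End Piv.

(** * Extension to the generated left ideal *)

Section Left.
Variables (R : comPzRingType) (C : pivotalKCat R) (O : C -> Prop).
Variable t : end_family O.
Implicit Types X Y Z W U V : C.

Lemma compZDl X Y Z (f : mor X Y) a (g h : mor Y Z) :
  (a *: g + h)%R ∘ f = (a *: (g ∘ f) + (h ∘ f))%R.
Proof. exact: comp_linear_l. Qed.

Lemma compZDr X Y Z (g : mor Y Z) a (f h : mor X Y) :
  g ∘ (a *: f + h)%R = (a *: (g ∘ f) + (g ∘ h))%R.
Proof. exact: comp_linear_r. Qed.

Lemma ptrlZD X Y Z a (f g : mor (X ⊗ Y) (X ⊗ Z)) :
  ptrl (a *: f + g)%R = (a *: ptrl f + ptrl g)%R.
Proof.
rewrite /ptrl -![lunit Z ∘ _ ∘ _ ∘ _ ∘ _ ∘ _ ∘ _]compA.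
by rewrite tensm_linear_r !(compZDl, compZDr).
Qed.

Hypothesis ambi : left_ambidextrous t.

(** Ambidexterity for the partial trace of [bend g h]; [piv_nat] removes the
    double dual that [ptrl_bend] leaves on one side. *)
Lemma ambi_cyclic X X' Y Y' (OX : O X) (OX' : O X')
    (g : mor (Y ⊗ X) (Y' ⊗ X')) (h : mor (Y' ⊗ X') (Y ⊗ X)) :
  t OX (ptrl (h ∘ g)) = t OX' (ptrl (g ∘ h)).
Proof.
have aK U V T (k : mor (U ⊗ V ⊗ T) (U ⊗ V ⊗ T)) :
  assocV U V T ∘ (assoc U V T ∘ k ∘ assocV U V T) ∘ assoc U V T = k.
  by coh.
have [_ /(_ X X' OX OX' (ptrl (assoc _ _ _ ∘ bend g h ∘ assocV _ _ _)))] := ambi.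
rewrite ptrl_tens ptrr_ptrl aK ptrr_bend ptrl_bend => <-.
by rewrite -compA -piv_nat compA pivK comp1m.
Qed.

(** A presentation of U as a retract is only known to exist, so the value of the
    extension is chosen among those computed from all presentations; they turn
    out to be equal by [gen_cyclic]. *)
Definition gen_spec U (f : mor U U) (r : R) :=
  exists X Y (OX : O X) (p : mor (Y ⊗ X) U) (q : mor U (Y ⊗ X)),
    p ∘ q = idm U /\ r = t OX (ptrl (q ∘ f ∘ p)).

Lemma gen_spec_ex U (IU : left_ideal_gen O U) (f : mor U U) :
  exists r, gen_spec f r.
Proof.
case: IU => X [Y [OX [p [q pq]]]].
by exists (t OX (ptrl (q ∘ f ∘ p))), X, Y, OX, p, q.
Qed.

Definition gen_trace : end_family (left_ideal_gen O) := fun U IU f =>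
  proj1_sig (constructive_indefinite_description _ (gen_spec_ex IU f)).

Lemma gen_cyclic X X' Y Y' (OX : O X) (OX' : O X') U V
    (p : mor (Y ⊗ X) U) (q : mor U (Y ⊗ X))
    (p' : mor (Y' ⊗ X') V) (q' : mor V (Y' ⊗ X')) (g : mor U V) (h : mor V U) :
  p ∘ q = idm U -> p' ∘ q' = idm V ->
  t OX' (ptrl (q' ∘ (g ∘ h) ∘ p')) = t OX (ptrl (q ∘ (h ∘ g) ∘ p)).
Proof.
move=> pq pq'.
have -> : q' ∘ (g ∘ h) ∘ p' = (q' ∘ g ∘ p) ∘ (q ∘ h ∘ p').
  by rewrite -!compA (compA p q) pq comp1m.
have -> : q ∘ (h ∘ g) ∘ p = (q ∘ h ∘ p') ∘ (q' ∘ g ∘ p).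
  by rewrite -!compA (compA p' q') pq' comp1m.
by apply: ambi_cyclic.
Qed.

Lemma gen_traceE U (IU : left_ideal_gen O U) X Y (OX : O X)
    (p : mor (Y ⊗ X) U) (q : mor U (Y ⊗ X)) (f : mor U U) :
  p ∘ q = idm U -> gen_trace IU f = t OX (ptrl (q ∘ f ∘ p)).
Proof.
move=> pq; rewrite /gen_trace.
case: constructive_indefinite_description => r /=.
move=> [X' [Y' [OX' [p' [q' [pq' ->]]]]]].
by have := gen_cyclic OX OX' f (idm U) pq pq'; rewrite compm1 comp1m.
Qed.

Lemma gen_trace_left : is_left_trace gen_trace.
Proof.
have [tlin _] := ambi.
split=> [U IU a f g|U V IU IV g h|U Y IU IYU f].
- have [X [Y [OX [p [q pq]]]]] := IU.
  by rewrite !(gen_traceE _ OX _ pq) compZDr compZDl ptrlZD tlin.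
- have [X [Y [OX [p [q pq]]]]] := IU.
  have [X' [Y' [OX' [p' [q' pq']]]]] := IV.
  by rewrite (gen_traceE _ OX _ pq) (gen_traceE _ OX' _ pq'); apply: gen_cyclic.
have [X [Z [OX [p [q pq]]]]] := IU.
(* A presentation of U by Z ⊗ X presents Y ⊗ U by (Y ⊗ Z) ⊗ X. *)
rewrite (gen_traceE _ OX _ pq) ptrl_nat ptrl_tens.
rewrite (@gen_traceE _ IYU X (Y ⊗ Z)%ob OX ((Y ◁ p) ∘ assoc Y Z X)
  (assocV Y Z X ∘ (Y ◁ q))); first by rewrite !compA.
rewrite -!compA (compA (assoc _ _ _)) eqm_comp eqm_id comp1m -whiskl_comp pq.
by rewrite tensm1.
Qed.

Lemma gen_trace_restrict : restrict (@sub_left_ideal_gen C O) gen_trace = t.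
Proof.
apply: functional_extensionality_dep => X.
apply: functional_extensionality_dep => OX.
apply: functional_extensionality_dep => f; rewrite /restrict.
rewrite (@gen_traceE _ _ X 𝟙%ob OX (lunit X) (lunitV X)); last first.
  by rewrite eqm_comp eqm_id.
rewrite ptrl_one -!compA !eqm_compA !eqm_comp !eqm_id comp1m.
by rewrite compm1.
Qed.

Lemma left_trace_uniq (T : end_family (left_ideal_gen O)) :
  is_left_trace T -> restrict (@sub_left_ideal_gen C O) T = t -> gen_trace = T.
Proof.
move=> [_ Tcyc Ttr] Tt.
apply: functional_extensionality_dep => U.
apply: functional_extensionality_dep => IU.
apply: functional_extensionality_dep => f.
have [X [Y [OX [p [q pq]]]]] := IU.
have IYX : left_ideal_gen O (Y ⊗ X).
  by apply: (left_ideal_genP O).2; apply: sub_left_ideal_gen.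
rewrite (gen_traceE _ OX _ pq) -Tt /restrict -(Ttr _ _ _ IYX).
by rewrite -compA (Tcyc _ _ IU IYX) -compA pq compm1.
Qed.

End Left.

(** * The reversed category *)

Section RevMon.
Variable C : strictMonCat.
Implicit Types X Y Z : C.

Lemma tensmA_rev X X' Y Y' Z Z' (f : mor X X') (g : mor Y Y') (h : mor Z Z') :
  castm (esym (tensA Z Y X)) (esym (tensA Z' Y' X')) (h ⊗ (g ⊗ f)) = h ⊗ g ⊗ f.
Proof. by apply: tot_inj; rewrite tot_castm !tot_tens ttensA. Qed.

Definition revMon : strictMonCat := @StrictMonCat C (@mor C) (@idm C) (@comp C)
  (@compA C) (@comp1m C) (@compm1 C) (@one C) (fun X Y => Y ⊗ X)%ob
  (fun X X' Y Y' f g => g ⊗ f) (fun X Y => tensm1 Y X)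
  (fun X X' X'' Y Y' Y'' g f g' f' => tensm_comp g' f' g f)
  (fun X Y Z => esym (tensA Z Y X)) (@tens1r C) (@tens1l C)
  tensmA_rev (@tensm1r C) (@tensm1l C).

Lemma assocV_rev X Y Z : @assocV revMon X Y Z = assoc Z Y X.
Proof. exact: eqm_irr. Qed.

Lemma rev_duality (A B : C) (e : mor (A ⊗ B) 𝟙) (c : mor 𝟙 (B ⊗ A)) :
  is_duality e c -> @is_duality revMon B A e c.
Proof. by case=> l r; split; rewrite ?assocV_rev. Qed.
End RevMon.

Definition revDual (C : dualityCat) : dualityCat :=
  @DualityCat (revMon C) (@dual C) (@evr C) (@coevr C) (@ev C) (@coev C)
  (fun X => rev_duality (right_duality X)) (fun X => rev_duality (left_duality X)).

Section RevDual.
Variable C : dualityCat.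
Implicit Types X Y Z : C.

Lemma ldual_rev X Y (f : mor X Y) : @ldual (revDual C) X Y f = rdual f.
Proof. by rewrite /ldual assocV_rev. Qed.

Lemma rdual_rev X Y (f : mor X Y) : @rdual (revDual C) X Y f = ldual f.
Proof. by []. Qed.

Lemma ldual_tens_rev X Y : @ldual_tens (revDual C) X Y = rdual_tens Y X.
Proof. by rewrite /ldual_tens !assocV_rev. Qed.

Lemma rdual_tens_rev X Y : @rdual_tens (revDual C) X Y = ldual_tens Y X.
Proof. by rewrite /rdual_tens !assocV_rev. Qed.
End RevDual.

Section RevPivDef.
Variable C : pivotalCat.

Lemma ldual_rdual_rev (X Y : C) (f : mor X Y) :
  @ldual (revDual C) X Y f = @rdual (revDual C) X Y f.
Proof. by rewrite ldual_rev rdual_rev ldual_rdual. Qed.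

Lemma ldual_rdual_tens_rev (X Y : C) :
  @ldual_tens (revDual C) X Y = @rdual_tens (revDual C) X Y.
Proof. by rewrite ldual_tens_rev rdual_tens_rev ldual_rdual_tens. Qed.

Definition revPiv : pivotalCat :=
  @PivotalCat (revDual C) ldual_rdual_rev ldual_rdual_tens_rev
    (esym (ldual_rdual_one C)).
End RevPivDef.

Section RevPiv.
Variable C : pivotalCat.
Implicit Types X Y Z : C.

Lemma ptrl_rev X Y Z (f : mor (Y ⊗ X) (Z ⊗ X)) :
  @ptrl (revPiv C) X Y Z f = ptrr f.
Proof. by rewrite /ptrl assocV_rev. Qed.

Lemma ptrr_rev X Y Z (f : mor (X ⊗ Y) (X ⊗ Z)) :
  @ptrr (revPiv C) X Y Z f = ptrl f.
Proof. by rewrite /ptrr assocV_rev. Qed.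

(** Reversal replaces the formula for the inverse pivotal structure by its mirror
    image. *)
Lemma pivV_rev X : @pivV (revPiv C) X = pivV X.
Proof.
have -> : @pivV (revPiv C) X = runit X ∘ (X ◁ evr X^∨) ∘ assoc X X^∨ X^∨^∨
    ∘ (coev X ⊗ idm X^∨^∨) ∘ lunitV X^∨^∨ by rewrite /pivV assocV_rev.
by apply: (@stab_inj C); rewrite -pivV_alt; coh.
Qed.

Lemma piv_rev X : @piv (revPiv C) X = piv X.
Proof.
have := @pivVK (revPiv C) X; rewrite pivV_rev.
move=> /(congr1 (fun k : mor X^∨^∨ X^∨^∨ => k ∘ piv X)).
by rewrite -[LHS]compA pivK compm1 comp1m.
Qed.
End RevPiv.

Definition revLin (R : comPzRingType) (C : linPivotalCat R) : linPivotalCat R :=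
  @LinPivotalCat R (revPiv C) (@lc_class R C).

Definition revK (R : comPzRingType) (C : pivotalKCat R) : pivotalKCat R :=
  @PivotalKCat R (revLin C) (@comp_linear_l R C) (@comp_linear_r R C)
   (fun X X' Y Y' g => @tensm_linear_r R C Y Y' X X' g)
   (fun X X' Y Y' f => @tensm_linear_l R C Y Y' X X' f)
   (@end_one_free R C).

Section Right.
Variables (R : comPzRingType) (C : pivotalKCat R) (O : C -> Prop).

Lemma ambi_rev (t : end_family O) :
  right_ambidextrous t -> @left_ambidextrous R (revK C) O t.
Proof.
move=> [tlin tamb]; split=> // X X' OX OX' f.
have := tamb X X' OX OX' f.
by rewrite ptrl_rev ptrr_rev pivV_rev piv_rev ldual_rev -ldual_rdual.
Qed.

Lemma trace_rev (I : C -> Prop) (t : end_family I) :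
  @is_left_trace R (revK C) I t <-> is_right_trace t.
Proof.
split=> -[tlin tcyc ttr]; split=> // X Y IX IY f;
  by have := ttr X Y IX IY f; rewrite ptrl_rev.
Qed.

End Right.

Theorem theorem10 (R : comPzRingType) (C : pivotalKCat R) (O : C -> Prop)
    (t : end_family O) :
  (left_ambidextrous t ->
     exists! T : end_family (left_ideal_gen O),
       is_left_trace T /\ restrict (@sub_left_ideal_gen C O) T = t)
  /\
  (right_ambidextrous t ->
     exists! T : end_family (right_ideal_gen O),
       is_right_trace T /\ restrict (@sub_right_ideal_gen C O) T = t).
Proof.
have left (D : pivotalKCat R) (P : D -> Prop) (u : end_family P) :
    left_ambidextrous u -> exists! T : end_family (left_ideal_gen P),
      is_left_trace T /\ restrict (@sub_left_ideal_gen D P) T = u.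
  move=> au; exists (gen_trace u); split.
    by split; [apply: gen_trace_left | apply: gen_trace_restrict].
  by move=> T [Ttr Tu]; apply: left_trace_uniq.
split; first exact: left.
move=> /ambi_rev/left [T [[Ttr Tt] Tu]].
(* The two classes are the same, but the proofs that they contain O differ. *)
have sE : @sub_left_ideal_gen (revPiv C) O = @sub_right_ideal_gen C O.
  exact: proof_irrelevance.
exists T; split=> [|T' [T'tr T't]].
  by split; [apply/trace_rev | rewrite -sE].
by apply: Tu; split; [apply/trace_rev | rewrite -T't -sE].
Qed.
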